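(* Let $H$ be a real Hilbert space, $C\subseteq H$ a nonempty closed convex subset, and $f:H\times H\to\mathbb{R}\cup\{+\infty\}$ a bifunction with $f(x,y)<+\infty$ for all $x,y\in C$. Let $\mathrm{Sol}(C,f)=\{x\in C: f(x,y)\ge 0\ \forall y\in C\}$. Assume: (A1) $f(x,x)=0$ for all $x\in C$; (A2) $f$ is pseudomonotone on $C$: for all $x,y\in C$, $f(x,y)\ge 0$ implies $f(y,x)\le 0$; (A3) for every sequence $\{z^k\}\subset C$ with $z^k\rightharpoonup z$, if $\limsup_{k\to\infty} f(z^k,y)\ge 0$ for all $y\in C$, then $z\in \mathrm{Sol}(C,f)$; (A4) for every $x\in C$, $f(x,\cdot)$ is convex, lower semicontinuous and subdifferentiable on $C$; (A5) there are constants $c_1,c_2>0$ such that $f(x,y)+f(y,z)\ge f(x,z)-c_1\|x-y\|^2-c_2\|y-z\|^2$ for all $x,y,z\in C$; (A6) either $\mathrm{int}\,C\ne\emptyset$, or for every $x\in C$ the function $f(x,\cdot)$ is continuous at some point of $C$; (A7) for all bounded sequences $\{u^k\},\{v^k\}\subset C$ with $\|u^k-v^k\|\to 0$ one has $\limsup_{k\to\infty} f(u^k,v^k)\ge 0$; (A8) $\mathrm{Sol}(C,f)\neq\emptyset$. Let $\varphi=\frac{\sqrt5+1}{2}$ and let $\lambda$ satisfy $0<\lambda\le\min\left\{\frac{\varphi}{4c_1},\frac{\varphi}{4c_2}\right\}$. Let $x^0,y^1\in C$ be arbitrary and, for $k\ge 1$, define $$x^k=\frac{(\varphi-1)y^k+x^{k-1}}{\varphi},\qquad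 y^{k+1}=\operatorname{argmin}\left\{\lambda f(y^k,y)+\tfrac12\|y-x^k\|^2: y\in C\right\}.$$ Then the sequence $\{x^k\}$ converges weakly to an element of $\mathrm{Sol}(C,f)$.
   Context: $\rightharpoonup$ denotes weak convergence in $H$. The equilibrium problem asks for $\bar x\in C$ with $f(\bar x,y)\ge 0$ for all $y\in C$; $\mathrm{Sol}(C,f)$ is its solution set. A convex function $g:H\to(-\infty,+\infty]$ is subdifferentiable on $C$ if $\partial g(x)=\{w\in H: g(y)-g(x)\ge\langle w,y-x\rangle\ \forall y\in H\}$ is nonempty for every $x\in C$. The algorithm also carries the stopping criterion ''stop if $y^{k+1}=y^k=x^k$''; the convergence assertion concerns the infinite sequence produced by the recursion. *)

(* Defs.v *)
From HB Require Import structures.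
From mathcomp Require Export all_boot all_order all_algebra.
From mathcomp Require Export sesquilinear.
From mathcomp Require Export all_classical all_reals all_analysis.
Export Order.TTheory GRing.Theory Num.Theory.
Export numFieldNormedType.Exports.
#[export] Set Implicit Arguments.
#[export] Unset Strict Implicit.
#[export] Unset Printing Implicit Defensive.

Local Open Scope classical_set_scope.
Local Open Scope ring_scope.

(* A real Hilbert space is a complete normed module over a realType, together
   with a real inner product [dot : {dot H for idfun}] inducing its norm. *)
Definition induces_norm (R : realType) (H : normedModType R)
    (dot : {dot H for @idfun R}) : Prop :=
  forall x : H, dot x x = `|x| ^+ 2.

(* In a Hilbert space every continuous linear functional is [dot ^~ w] for
   some [w]; weak convergence is tested against these functionals. *)
Definition weakly_cvg (R : realType) (H : normedModType R)
    (dot : {dot H for @idfun R}) (u : nat -> H) (l : H) : Prop :=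
  forall w : H, dot (u n) w @[n --> \oo] --> dot l w.

Section extended_real_functions.
Context {R : realType} {H : normedModType R}.
Implicit Types (C : set H) (g : H -> \bar R).

(* Meant for functions that do not take the value -oo, so that the right-hand
   side has no indeterminate sum (and 0 * +oo = 0). *)
Definition econvex_on C g : Prop :=
  forall x y (t : R), C x -> C y -> 0 <= t <= 1 ->
    (g (t *: x + (1 - t) *: y)%R <= t%:E * g x + (1 - t)%R%:E * g y)%E.

(* Points outside C are isolated in [subspace C], so this only constrains the
   restriction of g to C. *)
Definition lsc_on C g : Prop :=
  lower_semicontinuous (g : subspace C -> \bar R).

(* Since +oo - +oo = -oo in \bar R, the set is empty when g x = +oo. *)
Definition subdifferential (dot : {dot H for @idfun R}) g (x : H) : set H :=
  [set w | forall y, ((dot w (y - x)%R)%:E <= g y - g x)%E].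

Definition subdifferentiable_on (dot : {dot H for @idfun R}) C g : Prop :=
  forall x, C x -> subdifferential dot g x !=set0.

Definition argmin C g : set H :=
  [set z | C z /\ forall y, C y -> (g z <= g y)%E].

Definition Sol C (f : H -> H -> \bar R) : set H :=
  [set x | C x /\ forall y, C y -> (0 <= f x y)%E].

End extended_real_functions.

Definition golden_ratio (R : realType) : R := (Num.sqrt 5 + 1) / 2.
Arguments golden_ratio {R}.

(* Main.v *)
Require Import Defs.
From mathcomp Require Import ring lra.

(** Write [phi] for the golden ratio, so that [phi ^ 2 = phi + 1].  The proof
    is a Lyapunov argument followed by Opial's lemma.

    The point [y (k + 1)] minimizes a convex function plus half a squared
    distance, hence satisfies a variational inequality
    ([prox_variational]).  Take that inequality at step [k] with test point a
    solution [p], and at step [k - 1] with test point [y (k + 1)].  In the sum,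
    (A5) bounds the combination of the three values of [f] at pairs among
    [y (k - 1)], [y k], [y (k + 1)] by squared distances, and pseudomonotonicity
    discards the term [f (y k) p <= 0].  The step
    [phi x_k = (phi - 1) y_k + x_(k-1)] is designed so that, because
    [phi ^ 2 = phi + 1], the terms in [|y_(k+1) - x_k| ^ 2] cancel and
      [E k = (phi + 1) |x_k - p| ^ 2 + phi / 2 |y_(k-1) - y_k| ^ 2]
    decreases by at least [phi |x_k - y_k| ^ 2] ([golden_ratio_descent]); the
    bound on [lam] is what makes the coefficients of the two
    [|y_(k-1) - y_k| ^ 2] terms match.  Consequently [x_k - y_k],
    [x_k - y_(k+1)] and [y_k - y_(k+1)] tend to 0 and [|x_k - p|] converges
    for every solution [p].

    If a subsequence of [x] converges weakly to [l], so does the corresponding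
    subsequence of [y].  In the variational inequality the inner product
    vanishes in the limit, and (A7), applied to consecutive iterates, gives
    [limsup f (y_k) u >= 0] for every [u] in [C]; then [l] is a solution by
    (A3).  Opial's lemma ([opial]) turns this, together with the convergence of
    the distances to solutions, into weak convergence of the whole sequence.

    Opial's lemma needs weakly convergent subsequences of bounded sequences
    ([bounded_weakly_cvg_subseq]).  Along an ultrafilter finer than [\oo],
    the inner products of the [x_n] with a fixed vector converge, the limit
    functional is represented by a vector [l] ([riesz]), and one selects indices
    along which the vectors [x_n - l] are almost orthogonal; almost orthogonal bounded sequences tend weakly to 0
    because their partial sums grow only like the square root of the number of
    terms ([almost_orthogonal_weakly_cvg0]). *)

Local Open Scope classical_set_scope.
Local Open Scope ring_scope.

(** * Sequences and subsequences *)

Lemma cvg_dist_squeeze {R : realType} {V : normedModType R} {T : Type}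
    {F : set_system T} {FF : Filter F} (u : T -> V) (l : V) (e : T -> R) :
  (forall n, `|u n - l| <= e n) -> e @ F --> (0 : R) -> u @ F --> l.
Proof.
move=> ue e0; apply/cvgrPdist_lt => eps eps0.
apply: filterS (cvgr0_norm_lt _ e0 _ eps0) => n en.
by rewrite distrC (le_lt_trans (ue n))// (le_lt_trans (ler_norm _)).
Qed.

Lemma cvg_dist_sqr_squeeze {R : realType} {V : normedModType R} {T : Type}
    {F : set_system T} {FF : Filter F} (u : T -> V) (l : V) (e : T -> R) :
  (forall n, `|u n - l| ^+ 2 <= e n) -> e @ F --> (0 : R) -> u @ F --> l.
Proof.
move=> ue e0; apply/cvgrPdist_lt => eps eps0.
apply: filterS (cvgr0_norm_lt _ e0 _ (exprn_gt0 2 eps0)) => n en.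
rewrite distrC -ltr_sqr ?nnegrE ?(ltW eps0)//.
by rewrite (le_lt_trans (ue n))// (le_lt_trans (ler_norm _)).
Qed.

Lemma bounded_seqP {R : realType} {V : normedModType R} (u : nat -> V) :
  bounded_fun u <-> exists M, forall n, `|u n| <= M.
Proof.
have F : ProperFilter (globally [set: nat]) by exact: (@globally_properfilter _ _ 0%N).
split=> [/ex_bound[M uM]|[M uM]]; first by exists M => n; exact: uM.
by apply/ex_bound; exists M => n _; exact: uM.
Qed.

Lemma cvg_dist_sqr_bounded {R : realType} {V : normedModType R} (x : nat -> V) (p : V) :
  cvgn (fun n => `|x n - p| ^+ 2) -> exists M, forall n, `|x n| <= M.
Proof.
move=> /cvg_seq_bounded/bounded_seqP[B hB]; exists (B + 1 + `|p|) => n.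
have := hB n; rewrite ger0_norm ?exprn_ge0// => h.
have : `|x n - p| <= B + 1.
  by have := sqr_ge0 (`|x n - p| - 1); rewrite sqrrB; nra.
by have := ler_normD (x n - p) p; rewrite subrK; lra.
Qed.

(** The telescoping principle behind Lyapunov functions: the decrements [D] are
    dominated by the increments of a convergent sequence. *)
Lemma nonincreasing_by_cvg {R : realType} (E D : nat -> R) :
  (forall k, 0 <= E k) -> (forall k, 0 <= D k) ->
  (forall k, E k.+1 <= E k - D k) -> cvgn E /\ D @ \oo --> (0 : R).
Proof.
move=> E0 D0 ED.
have cE : cvgn E.
  apply: nonincreasing_is_cvgn; last by exists 0 => _ [k _ <-].
  by apply/nonincreasing_seqP => k; rewrite (le_trans (ED k))// gerBl.
split=> //; have /cvg_ex[l El] := cE.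
apply: (@squeeze_cvgr _ _ _ _ (cst 0) (fun k => E k - E k.+1)).
- by apply: nearW => k; rewrite D0 /= lerBrDl -lerBrDr ED.
- exact: cvg_cst.
- by rewrite -(subrr l); apply: cvgB => //; rewrite (cvg_shiftS E).
Qed.

Lemma frequently_subseq (P : nat -> Prop) :
  (forall N, exists n, (N <= n)%N /\ P n) ->
  exists2 h : nat -> nat, {homo h : i j / (i < j)%N} & forall n, P (h n).
Proof.
move=> /choice[s sP].
exists (fun n => iter n (fun m => s m.+1) (s 0)) => [|[|n]/=]; last 2 first.
- by have [] := sP 0%N.
- by have [] := sP (iter n (fun m => s m.+1) (s 0)).+1.
apply: homo_ltn => [y x z|n]; first exact: ltn_trans.
by have [] := sP (iter n (fun m => s m.+1) (s 0)).+1.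
Qed.

Lemma homo_ltn_ge_id (h : nat -> nat) : {homo h : i j / (i < j)%N} ->
  forall n, (n <= h n)%N.
Proof. by move=> hh; elim=> // n /leq_ltn_trans; apply; exact: hh. Qed.

Lemma cvg_homo_subseq {T : Type} (u : nat -> T) (F : set_system T) (h : nat -> nat) :
  {homo h : i j / (i < j)%N} -> u @ \oo --> F -> u (h n) @[n --> \oo] --> F.
Proof.
move=> hh uF A /uF[N _ NA]; exists N => // n /= Nn; apply: NA => /=.
exact: leq_trans Nn (homo_ltn_ge_id hh n).
Qed.

Lemma not_cvg_subseq {R : realType} (u : nat -> R) (l : R) :
  ~ (u @ \oo --> l) ->
  exists e, [/\ 0 < e & exists2 h : nat -> nat, {homo h : i j / (i < j)%N} &
    forall n, e <= `|u (h n) - l|].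
Proof.
move=> ul; apply: contrapT => nh; apply: ul; apply/cvgrPdist_lt => e e0.
apply: contrapT => ne; apply: nh; exists e; split => //.
apply: (@frequently_subseq (fun n => e <= `|u n - l|)) => N.
apply: contrapT => hN; apply: ne; exists N => // n /= Nn.
by rewrite distrC ltNge; apply/negP => en; apply: hN; exists n.
Qed.

Lemma limn_esup_ge0P {R : realType} (u : nat -> R) :
  (0 <= limn_esup (EFin \o u))%E <->
  forall e, 0 < e -> forall N, exists n, (N <= n)%N /\ - e < u n.
Proof.
split=> [u0 e e0 N|ue].
  apply: contrapT => hN; move: u0; apply/negP; rewrite -ltNge.
  apply: (@le_lt_trans _ _ (- e)%:E); last by rewrite lte_fin oppr_lt0.
  apply: (@le_trans _ _ (ereal_sup ((EFin \o u) @` [set n | (N <= n)%N]))).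
    apply: ereal_inf_lbound; exists [set n | (N <= n)%N] => //.
    by exists N.
  apply: ge_ereal_sup => _ [n Nn <-]; rewrite lee_fin leNgt; apply/negP => un.
  by apply: hN; exists n.
apply: le_ereal_inf_tmp => _ [A [N _ NA] <-]; apply/lee_addgt0Pr => e e0.
have [n [Nn un]] := ue e e0 N.
rewrite -leeBlDr// sub0e; apply: (@le_trans _ _ (u n)%:E).
  by rewrite -EFinN lee_fin ltW.
by apply: ereal_sup_ubound; exists n => //; exact: NA.
Qed.

(** The values of [g] stay in a segment, which is compact, so they accumulate
    along [U]; an ultrafilter converges to any of its cluster points. *)
Lemma bounded_ultra_cvg {R : realType} {T : Type} (U : set_system T) (g : T -> R) (B : R) :
  UltraFilter U -> (forall n, `|g n| <= B) -> cvg (g @ U).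
Proof.
move=> UU gB; have gI : (g @ U) `[- B, B]%classic.
  by apply: (@filterE _ U) => n; rewrite /= in_itv /= -ler_norml.
have [p [_ gp]] := segment_compact _ gI; apply/cvg_ex; exists p => A pA.
have [//|gA] := in_ultra_setVsetC (g @^-1` A) UU.
by have [x [? ]] := gp (~` A) A gA pA.
Qed.

(** * Inner products *)

Section inner_product.
Context {R : realType} {H : normedModType R} {dot : {dot H for @idfun R}}.

Lemma dotC u v : dot u v = dot v u.
Proof. by rewrite hermC /= expr0 mul1r. Qed.

Lemma dotDl u v w : dot (u + v) w = dot u w + dot v w.
Proof. exact: linearDl. Qed.

Lemma dotNl u w : dot (- u) w = - dot u w.
Proof. exact: linearNl. Qed.

Lemma dotZl a u w : dot (a *: u) w = a * dot u w.
Proof. exact: linearZl_LR. Qed.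

Lemma dotDr u v w : dot w (u + v) = dot w u + dot w v.
Proof. exact: linearDr. Qed.

Lemma dotNr u w : dot w (- u) = - dot w u.
Proof. exact: linearNr. Qed.

Lemma dotZr a u w : dot w (a *: u) = a * dot w u.
Proof. exact: linearZr_LR. Qed.

Lemma dot0l w : dot 0 w = 0.
Proof. exact: linear0l. Qed.

Definition dot_lin := (dotDl, dotDr, dotNl, dotNr, dotZl, dotZr).

Hypothesis dotE : induces_norm dot.

Lemma dot_ge0 u : 0 <= dot u u.
Proof. by rewrite dotE exprn_ge0. Qed.

Lemma dot_eq0 u : (dot u u == 0) = (u == 0).
Proof. by rewrite dotE sqrf_eq0 normr_eq0. Qed.

(** Lets vector identities be checked by [ring] after expanding inner products. *)
Lemma dot_inj (u v : H) : (forall w, dot u w = dot v w) -> u = v.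
Proof.
move=> uv; apply/eqP; rewrite -subr_eq0 -dot_eq0 dotDl dotNl.
by rewrite uv subrr.
Qed.

Lemma cauchy_schwarz u v : `|dot u v| <= `|u| * `|v|.
Proof.
have [->|v0] := eqVneq v 0; first by rewrite dotC dot0l normr0 mulr_ge0.
have vv : 0 < dot v v by rewrite lt_neqAle eq_sym dot_eq0 v0 dot_ge0.
rewrite -ler_sqr ?nnegrE ?mulr_ge0// exprMn -!dotE real_normK ?num_real//.
have := dot_ge0 (dot v v *: u - dot u v *: v); rewrite !dot_lin (dotC v u) => h.
rewrite -(ler_pM2l vv) -subr_ge0; apply: le_trans h _.
by lra.
Qed.

End inner_product.

(** * Weak convergence in Hilbert spaces *)

Section weak_convergence.
Context {R : realType} {H : completeNormedModType R} {dot : {dot H for @idfun R}}.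
Hypothesis dotE : induces_norm dot.

Lemma cvg_weakly_cvg (u : nat -> H) l : u @ \oo --> l -> weakly_cvg dot u l.
Proof.
move=> ul w; apply: (@cvg_dist_squeeze _ _ _ _ _ _ _ (fun n => `|u n - l| * `|w|)).
  by move=> n; rewrite -dotNl -dotDl; exact: cauchy_schwarz.
rewrite -(mul0r `|w|); apply: cvgM; last exact: cvg_cst.
by apply/norm_cvg0P; apply/subr_cvg0.
Qed.

Lemma weakly_cvg_sub0 (u v : nat -> H) (l : H) :
  weakly_cvg dot (fun n => u n - v n) 0 -> weakly_cvg dot v l ->
  weakly_cvg dot u l.
Proof.
move=> uv vl w; apply: cvg_sub0 (vl w).
rewrite -(dot0l (dot := dot) w); apply: cvg_trans (uv w).
by apply: near_eq_cvg; apply: nearW => n; rewrite /= dotDl dotNl.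
Qed.

(** The representing vector minimizes [J w = |w| ^ 2 - 2 L w].  By the
    parallelogram identity any minimizing sequence is Cauchy, and
    near-minimality of [v n] along the line directed by [w] forces
    [dot (v n) w] to be close to [L w]. *)
Lemma riesz (L : H -> R) (M : R) : scalar L -> (forall w, `|L w| <= M * `|w|) ->
  exists l, forall w, L w = dot l w.
Proof.
move=> Llin LM.
have L0 : L 0 = 0.
  by have := Llin (-1) 0 0; rewrite scaler0 addr0 mulN1r addNr.
have LD u v : L (u + v) = L u + L v by rewrite -[u]scale1r Llin mul1r scale1r.
have LZ a u : L (a *: u) = a * L u by rewrite -[a *: u]addr0 Llin L0 addr0.
have LN u : L (- u) = - L u by rewrite -scaleN1r LZ mulN1r.
pose J w := dot w w - 2 * L w.
have JM w : - M ^+ 2 <= J w.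
  rewrite /J dotE; have := LM w; rewrite ler_norml => /andP[_ h].
  by have := sqr_ge0 (`|w| - M); rewrite sqrrB; lra.
have JI : has_inf (range J).
  split; first by exists (J 0), 0.
  by exists (- M ^+ 2) => _ [w _ <-].
pose m := inf (range J).
have mJ w : m <= J w by apply: ge_inf; [exact: JI.2|exists w].
have /choice[v Jv] : forall n, exists w, J w < m + harmonic n.
  move=> n; have n0 : 0 < harmonic n :> R by exact: harmonic_gt0.
  by have [_ [w _ <-] ?] := inf_adherent n0 JI; exists w.
have vB n p : `|v n - v p| ^+ 2 <= 2 * harmonic n + 2 * harmonic p.
  rewrite -dotE; have := mJ (2^-1 *: (v n + v p)); have := Jv n; have := Jv p.
  by rewrite /J !(LZ, LD) !dot_lin (dotC (v p) (v n)); lra.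
have : cvg (v @ \oo).
  apply/cauchy_cvgP/cauchy_exP => e e0.
  have e20 : 0 < e ^+ 2 / 4 by rewrite divr_gt0// exprn_gt0.
  have [N _ hN] := cvgr0_norm_lt _ (@cvg_harmonic R) _ e20.
  exists (v N); exists N => // n /= Nn; rewrite -ball_normE /=.
  rewrite -ltr_sqr ?nnegrE// ?(ltW e0)//; apply: le_lt_trans (vB _ _) _.
  have := hN N (leqnn N); have := hN n Nn.
  by rewrite !gtr0_norm ?harmonic_gt0//; lra.
move=> /cvg_ex[l vl]; exists l => w.
have vw : dot (v n) w @[n --> \oo] --> L w.
  have key n : (dot (v n) w - L w) ^+ 2 <= harmonic n * dot w w.
    have [w0|w0] := eqVneq w 0.
      by rewrite w0 L0 dotC !dot0l subr0 expr0n mulr0.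
    have ww : 0 < dot w w.
      by rewrite lt_neqAle eq_sym (dot_eq0 dotE) w0 (dot_ge0 dotE).
    set d := dot (v n) w - L w.
    (* The step [s] minimizes [J] on the line through [v n] directed by [w]. *)
    set s := d / dot w w.
    have sd : s * dot w w = d by rewrite /s mulfVK// gt_eqF.
    have -> : d ^+ 2 = s * d * dot w w by rewrite -sd; ring.
    rewrite ler_pM2r//.
    have -> : s * d = 2 * s * d - s * (s * dot w w) by rewrite sd; ring.
    have := mJ (v n - s *: w); have := Jv n.
    by rewrite /J !(LD, LN, LZ) !dot_lin (dotC w (v n)) /d; lra.
  apply: (@cvg_dist_sqr_squeeze _ R^o _ _ _ _ _ (fun n => harmonic n * dot w w)).
    by move=> n; rewrite real_normK ?num_real.
  by rewrite -(mul0r (dot w w)); apply: cvgM; [exact: cvg_harmonic|exact: cvg_cst].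
apply: cvg_unique vw _; [exact: Rhausdorff|exact: cvg_weakly_cvg].
Qed.

(** Along an ultrafilter every bounded real family converges, so the limit of
    [dot (x n) w] exists for all [w] at once and is a bounded linear functional
    of [w]. *)
Lemma ultra_weak_limit {T : Type} (U : set_system T) (x : T -> H) (M : R) :
  UltraFilter U -> (forall n, `|x n| <= M) ->
  exists l, forall w, dot (x n) w @[n --> U] --> dot l w.
Proof.
move=> UU xM; pose L w : R := lim (dot (x n) w @[n --> U]).
have bd w n : `|dot (x n) w| <= M * `|w|.
  by rewrite (le_trans (cauchy_schwarz dotE _ _))// ler_wpM2r.
have xL w : dot (x n) w @[n --> U] --> L w.
  exact: (bounded_ultra_cvg UU (bd w)).
have [] := @riesz L M.
- move=> a u v; apply: (@cvg_lim _ (@Rhausdorff R)).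
  under eq_fun do rewrite !dot_lin.
  by apply: cvgD (xL v); apply: cvgM; [exact: cvg_cst|exact: xL].
- move=> w; rewrite ler_norml; apply/andP; split.
    apply: limr_ge; first by apply/cvg_ex; exists (L w); exact: xL.
    by apply: nearW => n; have := bd w n; rewrite ler_norml => /andP[].
  apply: limr_le; first by apply/cvg_ex; exists (L w); exact: xL.
  by apply: nearW => n; have := bd w n; rewrite ler_norml => /andP[].
by move=> l Ll; exists l => w; rewrite -Ll; exact: xL.
Qed.

(** The bound [1 / (k + 1)] makes the [k] inner products of [z k] with the
    earlier terms sum to at most 1. *)
Definition almost_orthogonal (dot : {dot H for @idfun R}) (z : nat -> H) :=
  forall j k, (j < k)%N -> `|dot (z k) (z j)| <= k.+1%:R^-1.

(** If [dot (z n) v >= e] held infinitely often, the sum [S n] of [n] such terms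
    would satisfy [dot (S n) v >= n e], whereas almost orthogonality gives
    [|S n| ^ 2 <= n (M ^ 2 + 2)]; by Cauchy-Schwarz this fails for large
    [n]. *)
Lemma almost_orthogonal_weakly_cvg0 (z : nat -> H) (M : R) :
  almost_orthogonal dot z -> (forall n, `|z n| <= M) -> weakly_cvg dot z 0.
Proof.
move=> oz zM w; rewrite dot0l; apply/cvgrPdist_lt => e e0.
have M0 : 0 <= M by exact: le_trans (zM 0).
suff main v : \forall n \near \oo, dot (z n) v < e.
  apply: filterS2 (main w) (main (- w)) => n.
  by rewrite dotNr sub0r normrN ltr_norml => -> ?; rewrite andbT; lra.
have [//|] := pselect (\forall n \near \oo, dot (z n) v < e).
move=> fz; have [] := @frequently_subseq (fun n => e <= dot (z n) v).
  move=> N; apply: contrapT => hN; apply: fz; exists N => // n /= Nn.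
  by rewrite ltNge; apply/negP => en; apply: hN; exists n.
move=> h hh he.
pose S n := \sum_(i < n) z (h i).
have Sv n : n%:R * e <= dot (S n) v.
  elim: n => [|n IH]; first by rewrite /S big_ord0 dot0l mul0r.
  by rewrite /S big_ord_recr /= dotDl -natr1 mulrDl mul1r lerD.
have Sz n m : (m <= n)%N -> dot (S m) (z (h n)) <= m%:R * n.+1%:R^-1.
  elim: m => [|m IH] mn; first by rewrite /S big_ord0 dot0l mul0r.
  rewrite /S big_ord_recr /= dotDl -natr1 mulrDl mul1r lerD//.
    by apply: IH; exact: ltnW.
  rewrite dotC (le_trans (ler_norm _))// (le_trans (oz _ _ (hh _ _ mn)))//.
  by rewrite lef_pV2 ?posrE// ler_nat ltnS homo_ltn_ge_id.
have SS n : dot (S n) (S n) <= n%:R * (M ^+ 2 + 2).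
  elim: n => [|n IH]; first by rewrite /S big_ord0 dot0l mul0r.
  rewrite /S big_ord_recr /= -/(S n) !dot_lin -natr1 (dotC (z (h n)) (S n)).
  have : dot (S n) (z (h n)) <= 1.
    rewrite (le_trans (Sz n n (leqnn n)))// ler_pdivrMr// mul1r ler_nat.
    by [].
  have : dot (z (h n)) (z (h n)) <= M ^+ 2 by rewrite dotE lerXn2r// nnegrE.
  by rewrite mulrDl mul1r; lra.
have [n hn] : exists n : nat, (M ^+ 2 + 2) * `|v| ^+ 2 < n%:R * e ^+ 2.
  have /archi_boundP : 0 <= (M ^+ 2 + 2) * `|v| ^+ 2 / e ^+ 2.
    by rewrite divr_ge0 ?mulr_ge0 ?addr_ge0 ?exprn_ge0// ltW.
  by rewrite ltr_pdivrMr ?exprn_gt0//; eexists; eassumption.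
have n0 : (0 < n)%N.
  by case: n hn => //; rewrite mul0r ltNge mulr_ge0 ?addr_ge0 ?exprn_ge0.
have h1 : (n%:R * e) ^+ 2 <= `|S n| ^+ 2 * `|v| ^+ 2.
  rewrite -exprMn lerXn2r ?nnegrE ?mulr_ge0 ?(ltW e0)//.
  by rewrite (le_trans (Sv n))// (le_trans (ler_norm _))// cauchy_schwarz.
have h2 : `|S n| ^+ 2 * `|v| ^+ 2 <= n%:R * (M ^+ 2 + 2) * `|v| ^+ 2.
  by rewrite ler_wpM2r ?exprn_ge0// -dotE.
exfalso; move: (le_trans h1 h2); rewrite exprMn expr2 -!mulrA ler_pM2l ?ltr0n//.
by rewrite leNgt hn.
Qed.

(** Take a weak limit [l] along an ultrafilter finer than [\oo].  As [x n - l]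
    tends weakly to 0 along it, one can always find a later index whose vector is
    almost orthogonal to the finitely many already chosen. *)
Lemma bounded_weakly_cvg_subseq (x : nat -> H) (M : R) :
  (forall n, `|x n| <= M) ->
  exists h, {homo h : i j / (i < j)%N} /\ exists l, weakly_cvg dot (x \o h) l.
Proof.
move=> xM; have [U [UU ooU]] := ultraFilterLemma eventually_filter.
have [l xl] := ultra_weak_limit UU xM.
pose z n := x n - l.
have zU w : dot (z n) w @[n --> U] --> (0 : R).
  rewrite -(subrr (dot l w)); under eq_fun do rewrite !dot_lin.
  by apply: cvgB (xl w) _; exact: cvg_cst.
have /choice[s sP] : forall q : seq nat, exists n, forall j, j \in q ->
    (j < n)%N /\ `|dot (z n) (z j)| <= (size q).+1%:R^-1.
  move=> q; have : 0 < (size q).+1%:R^-1 :> R by rewrite invr_gt0.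
  move: _^-1 => e e0; suff /filter_ex : \forall n \near U, forall j, j \in q ->
    (j < n)%N /\ `|dot (z n) (z j)| <= e by [].
  elim: q => [|a q IH]; first by apply: (@filterE _ U).
  have an : \forall n \near U, (a < n)%N by apply: ooU; exists a.+1.
  apply: filterS3 an (cvgr0_norm_le _ (zU (z a)) _ e0) IH => n ? ? hn j.
  by rewrite inE => /predU1P[->|/hn].
(* [prev n] lists the [n] indices already chosen, the latest first. *)
pose prev := fix prev n := if n is m.+1 then s (prev m) :: prev m else [::].
pose h n := s (prev n).
have size_prev n : size (prev n) = n by elim: n => //= n ->.
have mem_prev j k : (j < k)%N -> h j \in prev k.
  elim: k => // k IH; rewrite ltnS leq_eqVlt => /predU1P[->|/IH jk].
    by rewrite /= inE eqxx.
  by rewrite /= inE jk orbT.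
have hh : {homo h : i j / (i < j)%N} by move=> i j /mem_prev/sP[].
exists h; split => //; exists l.
have zM n : `|(z \o h) n| <= M + `|l|.
  by rewrite (le_trans (ler_normB _ _))// lerD2r xM.
have oz : almost_orthogonal dot (z \o h).
  by move=> j k /mem_prev/sP[_]; rewrite size_prev.
apply: (@weakly_cvg_sub0 _ (cst l)); last by move=> w; rewrite /=; exact: cvg_cst.
exact: almost_orthogonal_weakly_cvg0 oz zM.
Qed.

(** A point of [S] makes [x] bounded, so weak subsequential limits exist.  Two
    weak subsequential limits [p] and [q] lie in [S]; by polarization
    [dot (x n) (q - p)] is a combination of the convergent
    [|x n - p| ^ 2] and [|x n - q| ^ 2], so its limits along the two
    subsequences agree: [dot p (q - p) = dot q (q - p)], that is, [p = q]. *)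
Lemma opial (x : nat -> H) (S : set H) : S !=set0 ->
  (forall p, S p -> cvgn (fun n => `|x n - p| ^+ 2)) ->
  (forall h l, {homo h : i j / (i < j)%N} -> weakly_cvg dot (x \o h) l -> S l) ->
  exists2 p, S p & weakly_cvg dot x p.
Proof.
move=> [p0 Sp0] fejer cluster.
have [M xM] := cvg_dist_sqr_bounded (fejer _ Sp0).
have [h0 [h0h [p xp]]] := bounded_weakly_cvg_subseq xM.
have Sp := cluster _ _ h0h xp; exists p => // w; apply: contrapT.
move=> /not_cvg_subseq[e [e0 [h1 h1h xe]]].
have [h2 [h2h [q xq]]] := @bounded_weakly_cvg_subseq (x \o h1) M (fun n => xM _).
have h12 : {homo h1 \o h2 : i j / (i < j)%N} by move=> i j /h2h/h1h.
have Sq : S q by exact: cluster h12 xq.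
have [c xc] : exists c, dot (x n) (q - p) @[n --> \oo] --> (c : R).
  have /cvg_ex[a xa] := fejer _ Sp; have /cvg_ex[b xb] := fejer _ Sq.
  exists (2^-1 * (a - b + (dot q q - dot p p))).
  have -> : (fun n => dot (x n) (q - p)) = (fun n => 2^-1 *
      (`|x n - p| ^+ 2 - `|x n - q| ^+ 2 + (dot q q - dot p p))).
    apply/funext => n; rewrite -!dotE !dot_lin (dotC p) (dotC q (x n)); lra.
  apply: cvgM; first exact: cvg_cst.
  by apply: cvgD; [exact: cvgB|exact: cvg_cst].
have cp : c = dot p (q - p).
  by apply: cvg_unique (xp _); [exact: Rhausdorff|exact: cvg_homo_subseq h0h xc].
have cq : c = dot q (q - p).
  by apply: cvg_unique (xq _); [exact: Rhausdorff|exact: cvg_homo_subseq h12 xc].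
have pq : q = p.
  by apply/eqP; rewrite -subr_eq0 -(dot_eq0 dotE) dotDl dotNl -cp -cq subrr.
have /cvgrPdist_lt/(_ _ e0)[N _ /(_ N (leqnn N))] := xq w.
by rewrite pq /= distrC ltNge xe.
Qed.

End weak_convergence.

(** * The proximal step *)

Section proximal_step.
Context {R : realType} {H : normedModType R} {dot : {dot H for @idfun R}}.
Hypothesis dotE : induces_norm dot.

Lemma convex_setP (C : set H) (u z : H) (t : R) : convex_set C ->
  C u -> C z -> 0 <= t <= 1 -> C (t *: u + (1 - t) *: z).
Proof.
move=> Cc Cu Cz /andP[t0 t1].
by have := Cc u z (Itv01 t0 t1) (mem_set Cu) (mem_set Cz) => /set_mem.
Qed.

(** Compare the minimizer [z] with the points [t u + (1 - t) z]: convexity of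
    [g] makes the gain linear in [t], while the quadratic error is of order
    [t ^ 2], so letting [t] tend to 0 leaves the first-order inequality. *)
Lemma prox_variational (C : set H) (g : H -> \bar R) (lam : R) (a z : H) :
  convex_set C -> econvex_on C g -> (forall u, C u -> g u \is a fin_num) ->
  0 < lam ->
  argmin C (fun u => lam%:E * g u + (2^-1 * `|u - a| ^+ 2)%:E)%E z ->
  forall u, C u -> dot (a - z) (u - z) <= lam * (fine (g u) - fine (g z)).
Proof.
move=> Cc gc gfin lam0 [Cz zmin] u Cu.
set D := dot (a - z) (u - z) - lam * (fine (g u) - fine (g z)).
suff : D <= 0 by rewrite subr_le0.
set B := dot (u - z) (u - z).
have key t : 0 < t <= 1 -> D <= t / 2 * B.
  move=> /andP[t0 t1]; have t01 : 0 <= t <= 1 by rewrite ltW.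
  set v := t *: u + (1 - t) *: z.
  have Cv : C v by exact: convex_setP.
  have := zmin v Cv; have := gc u z t Cu Cz t01; rewrite -/v.
  move: (gfin _ Cu) (gfin _ Cz) (gfin _ Cv); rewrite /D -!dotE.
  case: (g u) => // gu _; case: (g z) => // gz _; case: (g v) => // gv _ /=.
  rewrite -!EFinM -!EFinD !lee_fin => /(ler_wpM2l (ltW lam0)).
  rewrite /B /v => h1 h2; rewrite -(ler_pM2l t0); move: h1 h2.
  rewrite !dot_lin (dotC z u) (dotC a z) (dotC a u); lra.
(* If [D > 0], the step [t = D / (D + B)] contradicts [key]. *)
rewrite leNgt; apply/negP => D0.
have B0 : 0 <= B by exact: dot_ge0.
have DB : 0 < D + B by rewrite ltr_wpDr.
have := key (D / (D + B)).
rewrite divr_gt0// ler_pdivrMr// mul1r lerDl B0 => /(_ isT).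
rewrite -mulrA mulrAC ler_pdivlMr// ler_pM2l//; lra.
Qed.

End proximal_step.

(** * The golden ratio descent inequality *)

Lemma golden_ratio_sqr {R : realType} :
  golden_ratio ^+ 2 = golden_ratio + 1 :> R.
Proof.
have s5 : Num.sqrt 5 ^+ 2 = 5 :> R by rewrite sqr_sqrtr.
by rewrite /golden_ratio expr_div_n sqrrD s5; lra.
Qed.

Lemma golden_ratio_gt1 {R : realType} : 1 < golden_ratio :> R.
Proof.
have : 1 < Num.sqrt 5 :> R by rewrite -[ltLHS]sqrtr1 ltr_sqrt//; lra.
by rewrite /golden_ratio; lra.
Qed.

Section descent.
Context {R : realType} {H : normedModType R} {dot : {dot H for @idfun R}}.
Hypothesis dotE : induces_norm dot.

(** One step of the algorithm.  The points [ym], [yk], [yn] are the consecutive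
    iterates [y (k - 1)], [y k], [y (k + 1)], and [xk], [xn] are [x k] and
    [x (k + 1)]; [Fab] stands for the value of [f] at the points named by [a]
    and [b].  Writing [phi (xn - p) = (phi - 1) (yn - p) + (xk - p)] expresses
    [|xn - p| ^ 2] through [|yn - p| ^ 2], and the latter is controlled by the
    sum of the two variational inequalities. *)
Lemma golden_ratio_descent (phi lam c1 c2 Fkp Fkn Fmk Fmn : R) (ym yk yn xk xn p : H) :
  phi = golden_ratio -> 0 < lam -> lam * c1 <= phi / 4 -> lam * c2 <= phi / 4 ->
  xn = phi^-1 *: ((phi - 1) *: yn + xk) ->
  dot (xk - yn) (p - yn) <= lam * (Fkp - Fkn) ->
  phi * dot (xk - yk) (yn - yk) <= lam * (Fmn - Fmk) ->
  Fmn - c1 * `|ym - yk| ^+ 2 - c2 * `|yk - yn| ^+ 2 <= Fmk + Fkn ->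
  Fkp <= 0 ->
  (phi + 1) * `|xn - p| ^+ 2 + phi / 2 * `|yk - yn| ^+ 2 <=
  (phi + 1) * `|xk - p| ^+ 2 + phi / 2 * `|ym - yk| ^+ 2 - phi * `|xk - yk| ^+ 2.
Proof.
move=> phiE lam0 l1 l2 xnE h1 h2 h3 h4.
have phi1 : 1 < phi by rewrite phiE golden_ratio_gt1.
have phi2 : phi ^+ 2 = phi + 1 by rewrite phiE golden_ratio_sqr.
(* A convex combination identity, where [phi * (phi - 1) = 1] normalizes the
   coefficient of [|yn - p| ^ 2]. *)
have xE : (phi + 1) * `|xn - p| ^+ 2 = `|yn - p| ^+ 2 + phi * `|xk - p| ^+ 2
    - (phi - 1) * `|yn - xk| ^+ 2.
  have -> : (phi + 1) * `|xn - p| ^+ 2 = `|phi *: (xn - p)| ^+ 2.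
    by rewrite normrZ exprMn real_normK ?num_real// phi2.
  have -> : phi *: (xn - p) = (phi - 1) *: (yn - p) + (xk - p).
    rewrite xnE scalerBr scalerA divff ?gt_eqF ?(lt_trans ltr01)// scale1r.
    by apply: (dot_inj dotE) => w; rewrite !dot_lin; ring.
  have -> : `|yn - p| ^+ 2 = phi * (phi - 1) * `|yn - p| ^+ 2.
    by rewrite mulrBr mulr1 -expr2 phi2 addrAC subrr add0r mul1r.
  by rewrite -!dotE !dot_lin (dotC p yn) (dotC p xk) (dotC xk yn); ring.
have l3 : lam * (Fmn - Fmk - Fkn) <= lam * c1 * `|ym - yk| ^+ 2 + lam * c2 * `|yk - yn| ^+ 2.
  by rewrite -!mulrA -mulrDr ler_pM2l//; lra.
have l4 : lam * c1 * `|ym - yk| ^+ 2 <= phi / 4 * `|ym - yk| ^+ 2 by rewrite ler_wpM2r// exprn_ge0.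
have l5 : lam * c2 * `|yk - yn| ^+ 2 <= phi / 4 * `|yk - yn| ^+ 2 by rewrite ler_wpM2r// exprn_ge0.
have l6 : lam * Fkp <= 0 by rewrite pmulr_rle0.
have n1 : `|yn - p| ^+ 2 = 2 * dot (xk - yn) (p - yn) + `|xk - p| ^+ 2 - `|yn - xk| ^+ 2.
  rewrite -!dotE !dot_lin (dotC p yn) (dotC p xk) (dotC xk yn); lra.
have n2 : phi * `|yn - xk| ^+ 2 = phi * `|xk - yk| ^+ 2 + phi * `|yk - yn| ^+ 2 - 2 * (phi * dot (xk - yk) (yn - yk)).
  rewrite -!dotE !dot_lin (dotC yn xk) (dotC yk xk) (dotC yn yk); lra.
rewrite xE; lra.
Qed.

End descent.

(** * Weak convergence of the golden ratio algorithm *)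

Theorem theorem3p1 (R : realType) (H : completeNormedModType R)
  (dot : {dot H for @idfun R}) (dotE : induces_norm dot)
  (C : set H) (C0 : C !=set0) (Cclosed : closed C) (Cconvex : convex_set C)
  (f : H -> H -> \bar R)
  (f_gtNy : forall x y, (-oo < f x y)%E)
  (f_lty : forall x y, C x -> C y -> (f x y < +oo)%E)
  (A1 : forall x, C x -> f x x = 0%E)
  (A2 : forall x y, C x -> C y -> (0 <= f x y)%E -> (f y x <= 0)%E)
  (A3 : forall (z : nat -> H) (l : H), (forall k, C (z k)) ->
    weakly_cvg dot z l ->
    (forall y, C y -> (0 <= limn_esup (fun k => f (z k) y))%E) ->
    Sol C f l)
  (A4 : forall x, C x ->
    [/\ econvex_on C (f x), lsc_on C (f x) & subdifferentiable_on dot C (f x)])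
  (c1 c2 : R) (c1_gt0 : 0 < c1) (c2_gt0 : 0 < c2)
  (A5 : forall x y z, C x -> C y -> C z ->
    (f x z - (c1 * `|x - y| ^+ 2)%:E - (c2 * `|y - z| ^+ 2)%:E
      <= f x y + f y z)%E)
  (A6 : interior C !=set0 \/
    forall x, C x -> exists2 y, C y & {for y, continuous (f x)})
  (A7 : forall u v : nat -> H, (forall k, C (u k)) -> (forall k, C (v k)) ->
    bounded_fun u -> bounded_fun v ->
    `|u k - v k| @[k --> \oo] --> (0 : R) ->
    (0 <= limn_esup (fun k => f (u k) (v k)))%E)
  (A8 : Sol C f !=set0)
  (phi := golden_ratio : R)
  (lam : R) (lam_gt0 : 0 < lam)
  (lam_le : lam <= Num.min (phi / (4 * c1)) (phi / (4 * c2)))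
  (x y : nat -> H) (x0 : C (x 0%N)) (y1 : C (y 1%N))
  (xE : forall k, (1 <= k)%N ->
    x k = phi^-1 *: ((phi - 1) *: y k + x k.-1))
  (yE : forall k, (1 <= k)%N ->
    argmin C (fun z => (lam%:E * f (y k) z + (2^-1 * `|z - x k| ^+ 2)%:E)%E)
      (y k.+1)) :
  exists2 p, Sol C f p & weakly_cvg dot x p.
Proof.
have phi1 : 1 < phi by exact: golden_ratio_gt1.
have phi0 : 0 < phi by exact: lt_trans phi1.
move: lam_le; rewrite le_min => /andP[].
rewrite invfM mulrA ler_pdivlMr// => lam1; rewrite invfM mulrA ler_pdivlMr// => lam2.
(* On [C] all values of [f] are finite, so computations can be done in [R]. The
   point [y 0] may lie outside [C], so indices of [y] are written as
   successors. *)
pose F a b := fine (f a b).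
have ffin a b : C a -> C b -> f a b \is a fin_num.
  by move=> Ca Cb; rewrite fin_numElt f_gtNy f_lty.
have fE a b : C a -> C b -> f a b = (F a b)%:E.
  by move=> Ca Cb; rewrite /F fineK// ffin.
have Cy k : C (y k.+1) by case: k => [//|k]; have [] := yE k.+1 isT.
have prox k u : C u ->
    dot (x k.+1 - y k.+2) (u - y k.+2) <= lam * (F (y k.+1) u - F (y k.+1) (y k.+2)).
  move=> Cu; have [cf _ _] := A4 _ (Cy k).
  exact: (prox_variational dotE Cconvex cf (fun u => ffin _ u (Cy k)) lam_gt0 (yE k.+1 isT) Cu).
(* All the differences of iterates that must vanish are combinations of the
   [w k]. *)
pose w k := x k - y k.+1.
have wE k : w k = phi *: (x k.+1 - y k.+1).
  apply: (dot_inj dotE) => v.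
  rewrite (xE k.+1)//= scalerBr scalerA divff ?gt_eqF// scale1r /w.
  by rewrite !dot_lin; ring.
have descent p k : Sol C f p ->
  (phi + 1) * `|x k.+3 - p| ^+ 2 + phi / 2 * `|y k.+2 - y k.+3| ^+ 2 <=
  (phi + 1) * `|x k.+2 - p| ^+ 2 + phi / 2 * `|y k.+1 - y k.+2| ^+ 2
    - phi * `|x k.+2 - y k.+2| ^+ 2.
  move=> [Cp p_sol].
  apply: (golden_ratio_descent dotE erefl lam_gt0 lam1 lam2 (xE k.+3 isT) (prox k.+1 p Cp)
    (Fmk := F (y k.+1) (y k.+2)) (Fmn := F (y k.+1) (y k.+3))).
  - by rewrite -dotZl -wE; exact: prox.
  - by have := A5 _ _ _ (Cy k) (Cy k.+1) (Cy k.+2); rewrite !fE// -!EFinD lee_fin.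
  - by have := A2 _ _ Cp (Cy k.+1) (p_sol _ (Cy k.+1)); rewrite fE// lee_fin.
have lyap p : Sol C f p ->
    cvgn (fun k => (phi + 1) * `|x k.+2 - p| ^+ 2 + phi / 2 * `|y k.+1 - y k.+2| ^+ 2)
    /\ phi * `|x k.+2 - y k.+2| ^+ 2 @[k --> \oo] --> (0 : R).
  move=> Sp; apply: nonincreasing_by_cvg => k; last exact: descent.
    by rewrite addr_ge0// mulr_ge0 ?exprn_ge0// ?addr_ge0 ?divr_ge0// ltW.
  by rewrite mulr_ge0 ?exprn_ge0// ltW.
have w0 : w k @[k --> \oo] --> (0 : H).
  have [p /lyap[_ h]] := A8; rewrite -(cvg_shiftS w).
  under eq_fun do rewrite /= wE.
  rewrite -(scaler0 _ phi); apply: cvgZ; first exact: cvg_cst.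
  apply: (cvg_dist_sqr_squeeze (e := fun k => phi * `|x k.+2 - y k.+2| ^+ 2)) h => k.
  by rewrite subr0 ler_peMl ?exprn_ge0// ltW.
have yy0 : y k.+1 - y k.+2 @[k --> \oo] --> (0 : H).
  have -> : (fun k => y k.+1 - y k.+2) = (fun k => w k.+1 - phi^-1 *: w k).
    apply/funext => k; rewrite (wE k) scalerA mulVf ?gt_eqF// scale1r /w.
    by rewrite opprB [RHS]addrC addrA subrK.
  rewrite -[X in _ --> X](subrr (0 : H)); apply: cvgB; first by rewrite (cvg_shiftS w).
  by rewrite -[X in _ --> X](scaler0 _ phi^-1); apply: cvgZ => //; exact: cvg_cst.
have fejer p : Sol C f p -> cvgn (fun k => `|x k - p| ^+ 2).
  move=> /lyap[/cvg_ex[l El] _]; apply/cvg_ex; exists ((phi + 1)^-1 * (l - phi / 2 * `|0 : H| ^+ 2)).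
  rewrite -(cvg_shiftn 2%N).
  have -> : [sequence `|x (n + 2)%N - p| ^+ 2]_n = (fun k => (phi + 1)^-1 *
     ((phi + 1) * `|x k.+2 - p| ^+ 2 + phi / 2 * `|y k.+1 - y k.+2| ^+ 2
      - phi / 2 * `|y k.+1 - y k.+2| ^+ 2)).
    by apply/funext => k /=; rewrite addn2 addrK mulKf// gt_eqF// addr_gt0.
  apply: cvgM; first exact: cvg_cst.
  apply: cvgB El _; apply: cvgM; first exact: cvg_cst.
  by rewrite !expr2; apply: cvgM; exact: cvg_norm.
have [M yM] : exists M, forall k, `|y k.+1| <= M.
  have [p0 /fejer/cvg_dist_sqr_bounded[B xB]] := A8.
  have /bounded_seqP[B' wB] : bounded_fun w.
    by apply: cvg_seq_bounded; apply/cvg_ex; exists 0.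
  exists (B + B') => k; have -> : y k.+1 = x k - w k by rewrite /w subKr.
  by rewrite (le_trans (ler_normB _ _))// lerD.
apply: (opial dotE A8 fejer) => h l hh xl.
apply: (A3 (fun i => y (h i).+1)) => [//||u Cu].
  apply: weakly_cvg_sub0 xl; apply: (cvg_weakly_cvg dotE).
  have -> : (fun i => y (h i).+1 - (x \o h) i) = (fun i => - w (h i)).
    by apply/funext => i; rewrite /w opprB.
  by rewrite -oppr0; apply: cvgN; exact: cvg_homo_subseq hh w0.
have -> : (fun i => f (y (h i).+1) u) = EFin \o (fun i => F (y (h i).+1) u).
  by apply/funext => i /=; rewrite fE.
apply/limn_esup_ge0P => e e0 N.
have : (0 <= limn_esup (fun i => f (y (h i).+1) (y (h i).+2)))%E.
  apply: A7 => //; try by apply/bounded_seqP; exists M.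
  by apply/norm_cvg0P; exact: (cvg_homo_subseq hh yy0).
have -> : (fun i => f (y (h i).+1) (y (h i).+2)) =
    EFin \o (fun i => F (y (h i).+1) (y (h i).+2)).
  by apply/funext => i /=; rewrite fE.
move=> /limn_esup_ge0P yyN.
(* The inner product in the variational inequality is at most
   [|w| (|u| + M)] in absolute value, so it is eventually below
   [lam * (e / 2)]; (A7) supplies the other half of [e]. The added 1 keeps the
   divisor [|u| + M + 1] positive. *)
have M0 : 0 <= M by exact: le_trans (yM 0%N).
have B0 : 0 < `|u| + M + 1 by rewrite ltr_wpDl// addr_ge0.
have e1 : 0 < lam * (e / 2) / (`|u| + M + 1) by rewrite !mulr_gt0// invr_gt0.
have ws : w (h i).+1 @[i --> \oo] --> (0 : H).
  by apply: (cvg_homo_subseq (u := fun k => w k.+1) hh); rewrite (cvg_shiftS w).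
have [N' _ wN] := cvgr0_norm_lt _ ws _ e1.
have e2 : 0 < e / 2 by rewrite divr_gt0.
have [n [nN yn]] := yyN _ e2 (maxn N N').
move: nN; rewrite geq_max => /andP[Nn N'n]; exists n; split => //.
have := wN n N'n; rewrite /= ltr_pdivlMr// => wn.
have wB : `|w (h n).+1| * `|u - y (h n).+2| <= `|w (h n).+1| * (`|u| + M + 1).
  rewrite ler_wpM2l// (le_trans (ler_normB _ _))// -addrA lerD2l.
  by rewrite (le_trans (yM _))// lerDl.
have := cauchy_schwarz dotE (w (h n).+1) (u - y (h n).+2).
rewrite ler_norml => /andP[cs _].
have := prox (h n) u Cu; rewrite -/(w (h n).+1) => px.
rewrite -(ltr_pM2l lam_gt0).
have : lam * - (e / 2) < lam * F (y (h n).+1) (y (h n).+2) by rewrite ltr_pM2l.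
lra.
Qed.
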